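(* Let $\mathcal{H}$ be a Hilbert space, let $T \in \mathcal{B}(\mathcal{H})$ be a $C_{\cdot 0}$-contraction, and let $\mathcal{S}$ be a non-trivial closed subspace of $\mathcal{H}$. Then $\mathcal{S}$ is a $T$-invariant subspace of $\mathcal{H}$ (that is, $T\mathcal{S} \subseteq \mathcal{S}$) if and only if there exist a Hilbert space $\mathcal{D}$ and a partially isometric operator $\Pi : H^2_{\mathcal{D}}(\mathbb{D}) \to \mathcal{H}$ such that \[\Pi M_z = T \Pi \quad \text{and} \quad \mathcal{S} = \operatorname{ran} \Pi .\]
   Context: All Hilbert spaces are separable and over $\mathbb{C}$. $\mathcal{B}(\mathcal{H})$ is the set of bounded linear operators on $\mathcal{H}$. A contraction $T$ on $\mathcal{H}$ (i.e. $\|Tf\| \le \|f\|$ for all $f \in \mathcal{H}$) is a $C_{\cdot 0}$-contraction if $T^{*m} \to 0$ as $m \to \infty$ in the strong operator topology. A non-trivial subspace is one different from $\{0\}$. $\mathbb{D} = \{z \in \mathbb{C} : |z| < 1\}$; for a Hilbert space $\mathcal{D}$, $H^2_{\mathcal{D}}(\mathbb{D})$ is the $\mathcal{D}$-valued Hardy space over $\mathbb{D}$, i.e. the Hilbert space of functions $f(z) = \sum_{m \ge 0} a_m z^m$ with $a_m \in \mathcal{D}$ and $\|f\|^2 = \sum_{m\ge 0} \|a_m\|^2 < \infty$, and $M_z$ is the shift $(M_z f)(z) = z f(z)$ on it. *)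

(* Defs.v *)
From HB Require Import structures.
From mathcomp Require Import all_boot all_order all_algebra.
From mathcomp Require Import complex.
From mathcomp Require Import sesquilinear all_classical reals topology normedtype.
From mathcomp Require Import interval_inference sequences ring lra.

Set Implicit Arguments.
Unset Strict Implicit.
Unset Printing Implicit Defensive.

Import Order.TTheory GRing.Theory Num.Theory.
Import numFieldNormedType.Exports.

Local Open Scope classical_set_scope.
Local Open Scope ring_scope.
Local Open Scope complex_scope.

HB.mixin Record isHilbert (R : realType) V & CompleteNormedModule R[i] V := {
  hdot : {dot V for Num.conj} ;
  hnormE : forall x : V, `|x| ^+ 2 = hdot x x
}.

#[short(type="hilbertType")]
HB.structure Definition Hilbert (R : realType) :=
  {V of CompleteNormedModule R[i] V & isHilbert R V}.

Notation "''[' u , v ]" := (hdot u v) : ring_scope.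

Definition separable_space (T : topologicalType) :=
  exists2 S : set T, countable S & dense S.

Section Norm.
Context {R : realType}.

(* The norm of a normed module over R[i] takes its values in R[i]; [rnorm] is
   the same norm seen in R. *)
Definition rnorm {V : normedModType R[i]} (x : V) : R := complex.Re `|x|.

Section NormTheory.
Context {V : normedModType R[i]}.
Implicit Types x y : V.

Lemma rnormE x : `|x| = (rnorm x)%:C.
Proof. by rewrite /rnorm RRe_real// normr_real. Qed.

Lemma rnorm_ge0 x : 0 <= rnorm x.
Proof. by rewrite -lecR -rnormE normr_ge0. Qed.

Lemma rnorm0 : rnorm (0 : V) = 0.
Proof. by rewrite /rnorm normr0. Qed.

Lemma rnormN x : rnorm (- x) = rnorm x.
Proof. by rewrite /rnorm normrN. Qed.

Lemma rnormB x y : rnorm (x - y) = rnorm (y - x).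
Proof. by rewrite /rnorm distrC. Qed.

Lemma rnorm_eq0 x : rnorm x = 0 -> x = 0.
Proof. by move=> h; apply/normr0_eq0; rewrite rnormE h. Qed.

Lemma rnormD x y : rnorm (x + y) <= rnorm x + rnorm y.
Proof. by rewrite -lecR rmorphD/= -!rnormE ler_normD. Qed.

Lemma rnormZ (a : R[i]) x : rnorm (a *: x) = complex.Re `|a| * rnorm x.
Proof.
by rewrite /rnorm normrZ (rnormE x) -{1}(RRe_real (normr_real a)) -rmorphM.
Qed.

Lemma rnorm_sum (u : nat -> V) m n :
  rnorm (\sum_(m <= k < n) u k) <= \sum_(m <= k < n) rnorm (u k).
Proof.
elim/big_ind2 : _ => //; first by rewrite rnorm0.
by move=> x1 x2 y1 y2 h1 h2; rewrite (le_trans (rnormD _ _))// lerD.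
Qed.

Lemma cvg_rnormP {T} {F : set_system T} {FF : Filter F} (f : T -> V) (l : V) :
  f @ F --> l <-> forall e : R, 0 < e -> \forall x \near F, rnorm (l - f x) < e.
Proof.
split=> [/cvgrPdist_lt h e e0|h].
  have := h e%:C; rewrite ltcR => /(_ e0); apply: filterS => x.
  by rewrite rnormE ltcR.
apply/cvgrPdist_lt => e e0.
have eE : e = (complex.Re e)%:C by rewrite RRe_real// gtr0_real.
have /h : 0 < complex.Re e by rewrite -ltcR -eE.
by apply: filterS => x; rewrite -ltcR -rnormE -eE.
Qed.

Lemma cvg_rnorm {T} {F : set_system T} {FF : Filter F} (f : T -> V) (l : V) :
  f @ F --> l -> rnorm (f x) @[x --> F] --> rnorm l.
Proof.
move=> /cvg_rnormP h; apply/cvgrPdist_lt => e /h; apply: filterS => x.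
apply: le_lt_trans; rewrite ler_norml; apply/andP; split.
  by rewrite lerNl opprB lerBlDr rnormB -{1}(subrK l (f x)) rnormD.
by rewrite lerBlDr -{1}(subrK (f x) l) rnormD.
Qed.

End NormTheory.

Section Series.
Context {V : completeNormedModType R[i]}.

Lemma rnormed_cvg (u : nat -> V) :
  cvgn (series (fun n => rnorm (u n))) -> cvgn (series u).
Proof.
move=> /cauchy_cvgP/cauchy_seriesP h; apply/cauchy_cvgP/cauchy_seriesP => e e0.
have eE : e = (complex.Re e)%:C by rewrite RRe_real// gtr0_real.
have /h : 0 < complex.Re e by rewrite -ltcR -eE.
apply: filterS => -[m n] /=; rewrite eE rnormE ltcR; apply: le_lt_trans.
by rewrite (le_trans (rnorm_sum _ _ _))// ler_norm.
Qed.

End Series.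
End Norm.

Section DotTheory.
Context {C : numClosedFieldType} {U : lmodType C} (d : {dot U for Num.conj}).
Implicit Types x y : U.

Lemma dotC x y : d x y = (d y x)^*%R.
Proof. by rewrite hermC/= expr0 mul1r. Qed.

Lemma dot_CauchySchwarz x y : `|d x y| ^+ 2 <= d x x * d y y.
Proof.
have [->|y0] := eqVneq y 0; first by rewrite !linear0r normr0 expr0n mulr0.
have b0 : 0 < d y y by rewrite dnorm_gt0.
have bN0 : d y y != 0 by rewrite gt_eqF.
have [c cdef] : exists c, c = d x y / d y y by exists (d x y / d y y).
have := dnorm_ge0 d (x - c *: y).
have bC : (d y y)^*%R = d y y by rewrite -dotC.
have -> : d (x - c *: y) (x - c *: y) = d x x - `|d x y| ^+ 2 / d y y.
  rewrite dnormB dnormZ linearZr_LR/= !normCK.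
  have cE : (c^* = (d x y)^* / d y y)%R by rewrite cdef rmorphM/= fmorphV/= bC.
  have -> : ((c^* * d x y)^* = c * (d x y)^*)%R by rewrite rmorphM/= conjCK.
  by rewrite cE cdef; field.
by rewrite subr_ge0 ler_pdivrMr.
Qed.

Lemma dot_triangle x y :
  sqrtC (d (x + y) (x + y)) <= sqrtC (d x x) + sqrtC (d y y).
Proof.
rewrite -(@ler_pXn2r _ 2)// ?nnegrE ?addr_ge0 ?sqrtC_ge0 ?dnorm_ge0//.
rewrite sqrtCK sqrrD !sqrtCK dnormD -addrA [d y y + _]addrC addrA lerD2r lerD2l.
have h : `|d x y| <= sqrtC (d x x) * sqrtC (d y y).
  rewrite -(@ler_pXn2r _ 2)// ?nnegrE ?mulr_ge0 ?sqrtC_ge0 ?dnorm_ge0//.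
  by rewrite exprMn !sqrtCK dot_CauchySchwarz.
apply: (@le_trans _ _ (`|d x y| *+ 2)); last by rewrite lerMn2r h orbT.
have -> : (d x y + (d x y)^* = 'Re (d x y) *+ 2)%R.
  by rewrite ReE -mulr_natr mulfVK// pnatr_eq0.
rewrite lerMn2r/= (le_trans _ (leif_normC_Re_Creal _).1)// real_ler_norm//.
Qed.

End DotTheory.

Section Riesz.
Context {R : realType} {H : hilbertType R}.
Implicit Types x y : H.

Lemma rnorm_sqr x : rnorm x ^+ 2 = complex.Re '[x, x].
Proof.
by apply: complexI; rewrite rmorphXn/= -rnormE hnormE RRe_real// ger0_real// dnorm_ge0.
Qed.

Lemma hCauchySchwarz x y : `|'[x, y]| <= `|x| * `|y|.
Proof.
rewrite -(@ler_pXn2r _ 2)// ?nnegrE ?mulr_ge0//.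
by rewrite exprMn !hnormE dot_CauchySchwarz.
Qed.

Lemma Re_dot_le x y : `|complex.Re '[x, y]| <= rnorm x * rnorm y.
Proof.
rewrite -lecR rmorphM/= -!rnormE.
by rewrite (le_trans (normc_ge_Re _))// hCauchySchwarz.
Qed.

Lemma Re_dotC x y : complex.Re '[x, y] = complex.Re '[y, x].
Proof. by rewrite dotC; case: '[y, x]. Qed.

Lemma rnorm_sqrD x y :
  rnorm (x + y) ^+ 2 = rnorm x ^+ 2 + rnorm y ^+ 2 + 2 * complex.Re '[x, y].
Proof.
rewrite !rnorm_sqr linearDl/= !linearDr/= !raddfD/= [complex.Re '[y, x]]Re_dotC.
by ring.
Qed.

Lemma hdot_inj x y : (forall w, '[w, x] = '[w, y]) -> x = y.
Proof.
move=> h; apply/eqP; rewrite -subr_eq0 -(dnorm_eq0 hdot) linearBr/=.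
by rewrite h subrr.
Qed.

Lemma rdotZ (t : R) x y : complex.Re '[t%:C *: x, y] = t * complex.Re '[x, y].
Proof. by rewrite linearZl_LR/=; case: '[x, y] => u v /=; rewrite mul0r subr0. Qed.

Lemma rnormZr (t : R) x : rnorm (t%:C *: x) ^+ 2 = t ^+ 2 * rnorm x ^+ 2.
Proof.
rewrite rnormZ exprMn; congr (_ * _).
by rewrite normc_def/= expr0n addr0 sqrtr_sqr real_normK// num_real.
Qed.

Lemma cvg_Re_dot (u : nat -> H) x y : u @ \oo --> x ->
  complex.Re '[u n, y] @[n --> \oo] --> complex.Re '[x, y].
Proof.
move=> /cvg_rnormP ux; apply/cvgrPdist_lt => e e0.
have y0 : 0 < rnorm y + 1 by rewrite ltr_wpDl// rnorm_ge0.
have /ux : 0 < e / (rnorm y + 1) by rewrite divr_gt0.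
apply: filterS => n h; rewrite -raddfB/= -linearBl/=.
rewrite (le_lt_trans (Re_dot_le _ _))//.
move: h; rewrite ltr_pdivlMr// => h.
apply: le_lt_trans h; rewrite ler_wpM2l ?rnorm_ge0//; lra.
Qed.

Lemma riesz (phi : H -> R[i]) :
  (forall (a : R[i]) x y, phi (a *: x + y) = a * phi x + phi y) ->
  (exists M : R, forall x, `|phi x| <= M%:C * `|x|) ->
  exists z, forall x, phi x = '[x, z].
Proof.
move=> phiL [M phiM].
have phi0 : phi 0 = 0.
  have := phiL 1 0 0; rewrite scaler0 addr0 mul1r => h.
  by apply: (addrI (phi 0)); rewrite -h addr0.
have phiD x y : phi (x + y) = phi x + phi y.
  by have := phiL 1 x y; rewrite scale1r mul1r.
have phiZ a x : phi (a *: x) = a * phi x.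
  by have := phiL a x 0; rewrite phi0 !addr0.
pose f x := complex.Re (phi x).
have fD x y : f (x + y) = f x + f y by rewrite /f phiD raddfD.
have fZ (t : R) x : f (t%:C *: x) = t * f x.
  by rewrite /f phiZ; case: (phi x) => u v /=; rewrite mul0r subr0.
have fM x : f x <= M * rnorm x.
  rewrite -lecR rmorphM/= -rnormE (le_trans _ (phiM x))//.
  by rewrite (le_trans _ (normc_ge_Re _))// lecR ler_norm.
pose J x := 2 * f x - rnorm x ^+ 2.
have JM x : J x <= M ^+ 2.
  have := fM x; have := sqr_ge0 (M - rnorm x); rewrite /J.
  by move: (f x) (rnorm x) => u v; nra.
have JD x y : J (x + y) = J x + J y - 2 * complex.Re '[x, y].
  by rewrite /J fD rnorm_sqrD; ring.
have JZ t x : J (t%:C *: x) = 2 * t * f x - t ^+ 2 * rnorm x ^+ 2.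
  by rewrite /J fZ rnormZr; ring.
pose s := sup (range J).
have hs : has_sup (range J).
  by split; [exists (J 0), 0 | exists (M ^+ 2) => _ [x _ <-]].
have Js x : J x <= s by apply: ub_le_sup; [exact: hs.2|exists x].
have /choice[x_ xP] (n : nat) : exists x, s - n.+1%:R^-1 < J x.
  have [|_ [x _ <-] hx] := @sup_adherent _ _ n.+1%:R^-1 _ hs.
    by rewrite invr_gt0 ltr0n.
  by exists x.
have par x y : rnorm (x - y) ^+ 2 <= 4 * s - 2 * (J x + J y).
  have := Js ((2^-1)%:C *: (x + y)).
  rewrite JZ fD rnorm_sqrD /J rnorm_sqrD rnormN.
  rewrite linearNr/= raddfN/=; lra.
have cx : cvgn x_.
  apply/cauchy_cvgP/cauchy_exP => e e0.
  have eE : e = (complex.Re e)%:C by rewrite RRe_real// gtr0_real.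
  move: e0; rewrite eE ltcR; set d := complex.Re e => d0.
  have d20 : 0 < d ^+ 2 / 4 by rewrite divr_gt0 ?exprn_gt0.
  have [N _ NP] := near_infty_natSinv_lt (PosNum d20).
  exists (x_ N); exists N => // n /= Nn; rewrite -ball_normE/= rnormE ltcR.
  rewrite -(@ltr_pXn2r _ 2)// ?nnegrE ?rnorm_ge0 ?(ltW d0)//.
  rewrite (le_lt_trans (par _ _))//.
  have := NP n Nn; have := NP N (leqnn N) => /=.
  have := xP n; have := xP N.
  move: (n.+1%:R^-1 : R) (N.+1%:R^-1 : R) => u v; lra.
pose z := limn x_.
have xz : x_ @ \oo --> z by [].
have key w (t : R) : 2 * t * (f w - complex.Re '[z, w]) <= t ^+ 2 * rnorm w ^+ 2.
  have h1 : 2 * t * (f w - complex.Re '[x_ n, w]) @[n --> \oo] -->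
      2 * t * (f w - complex.Re '[z, w]).
    by apply: cvgMr; apply: cvgB; [exact: cvg_cst|exact: cvg_Re_dot].
  have h2 : t ^+ 2 * rnorm w ^+ 2 + n.+1%:R^-1 @[n --> \oo] -->
      t ^+ 2 * rnorm w ^+ 2.
    rewrite -[X in _ --> X]addr0.
    by apply: cvgD; [exact: cvg_cst|exact: cvg_harmonic].
  apply: (ler_cvg_to h1 h2); near=> n.
  have := Js (x_ n + t%:C *: w).
  rewrite JD JZ Re_dotC rdotZ [complex.Re '[w, _]]Re_dotC.
  have := xP n; move: (n.+1%:R^-1 : R) (complex.Re _) => u v; lra.
have keyE w : f w = complex.Re '[z, w].
  apply/eqP; rewrite -subr_eq0.
  set A := f w - _; set B := rnorm w ^+ 2.
  have B0 : 0 <= B by rewrite sqr_ge0.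
  have B1 : 0 < B + 1 by rewrite ltr_wpDl.
  have := key w (A / (B + 1)).
  rewrite -/A -/B expr_div_n -[_ / _ ^+ 2 * _]mulrAC ler_pdivlMr ?exprn_gt0//.
  have -> : 2 * (A / (B + 1)) * A * (B + 1) ^+ 2 = 2 * A ^+ 2 * (B + 1).
    by field; rewrite gt_eqF.
  move=> h; rewrite -sqrf_eq0 eq_le sqr_ge0 andbT; have := sqr_ge0 A; nra.
exists z => w.
have h1 := keyE w.
have h2 := keyE ('i%C *: w).
move: h1 h2; rewrite Re_dotC [complex.Re '[z, _]]Re_dotC /f phiZ linearZl_LR/=.
case: (phi w) => u v; case: '[w, z] => u' v' /= -> /=.
by rewrite !mul0r !mul1r !sub0r => /oppr_inj ->.
Unshelve. all: by end_near.
Qed.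


End Riesz.

Section Operators.
Context {R : realType} {H K : hilbertType R}.

Definition bounded_operator (T : H -> K) :=
  exists M : R, forall x, `|T x| <= M%:C * `|x|.

Definition contractive (T : H -> K) := forall x, `|T x| <= `|x|.

(* The value at a [y] without a representing vector is irrelevant: see
   [adjointP] for bounded operators. *)
Definition adjoint (T : H -> K) (y : K) : H :=
  xget 0 [set z | forall x, '[T x, y] = '[x, z]].

Lemma adjointP (T : {linear H -> K}) : bounded_operator T ->
  forall x y, '[T x, y] = '[x, adjoint T y].
Proof.
move=> [M TM] x y; rewrite /adjoint; case: xgetP => [z _ /(_ x)//|h].
have [z zP] : exists z, forall x, '[T x, y] = '[x, z].
  apply: riesz => [a u v|]; first by rewrite linearP/= linearPl.
  exists (M * rnorm y) => u; rewrite (le_trans (hCauchySchwarz _ _))//.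
  by rewrite rmorphM/= -rnormE mulrAC ler_wpM2r// TM.
by have := h z zP.
Qed.

Definition partial_isometry (T : H -> K) :=
  bounded_operator T /\
  forall x, (forall y, T y = 0 -> '[x, y] = 0) -> `|T x| = `|x|.

End Operators.

Section CDot0.
Context {R : realType} {H : hilbertType R}.

Definition C_dot0 (T : H -> H) :=
  contractive T /\
  forall x, iter m (adjoint T) x @[m --> \oo] --> (0 : H).

Definition closed_subspace (S : set H) :=
  closed S /\ submod_closed (mem S).

End CDot0.

Section ComplexSeries.
Context {R : realType}.

Lemma cvg_complex (u : nat -> R[i]) (a b : R) :
  complex.Re (u n) @[n --> \oo] --> a -> complex.Im (u n) @[n --> \oo] --> b ->
  (u : nat -> R[i]^o) @ \oo --> (a +i* b : R[i]^o).
Proof.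
move=> /cvgrPdist_lt ha /cvgrPdist_lt hb; apply/cvg_rnormP => e e0.
have e2 : 0 < e / 2 by rewrite divr_gt0.
near=> n.
have h1 : `|a - complex.Re (u n)| < e / 2 by near: n; exact: ha.
have h2 : `|b - complex.Im (u n)| < e / 2 by near: n; exact: hb.
rewrite -ltcR -rnormE normc_def ltcR.
case: (u n) h1 h2 => p q /=; set x := a - p; set y := b - q => h1 h2.
rewrite -(@ltr_pXn2r _ 2)// ?nnegrE ?sqrtr_ge0 ?(ltW e0)//.
rewrite sqr_sqrtr ?addr_ge0 ?sqr_ge0// -[x ^+ 2]real_normK ?num_real//.
rewrite -[y ^+ 2]real_normK ?num_real//.
have := normr_ge0 x; have := normr_ge0 y; nra.
Unshelve. all: by end_near. Qed.

Lemma cvg_series_complex (u : nat -> R[i]) (v : nat -> R) :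
  (forall n, `|u n| <= (v n)%:C) -> cvgn (series v) ->
  cvgn (series (u : nat -> R[i]^o)).
Proof.
move=> uv cv.
have v0 n : 0 <= v n by rewrite -ler0c (le_trans _ (uv n)).
have hre : cvgn (series (fun n => complex.Re (u n))).
  apply: normed_cvg; apply: series_le_cvg cv => [n|//|n]; first exact: normr_ge0.
  by rewrite -lecR (le_trans (normc_ge_Re _)).
have him : cvgn (series (fun n => complex.Im (u n))).
  apply: normed_cvg; apply: series_le_cvg cv => [n|//|n]; first exact: normr_ge0.
  rewrite -lecR (le_trans _ (uv n))//.
  rewrite /=; have -> : complex.Im (u n) = - complex.Re (u n * 'i%C) by rewrite ReiNIm opprK.
  have ni : `|'i%C : R[i]| = 1 by rewrite normc_def/= expr0n expr1n add0r sqrtr1.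
  by rewrite normrN (le_trans (normc_ge_Re _))// normrM ni mulr1.
apply/cvg_ex; exists (limn (series (fun n => complex.Re (u n))) +i*
  limn (series (fun n => complex.Im (u n)))); apply: cvg_complex.
  have -> : (fun n => complex.Re (series u n)) = series (fun n => complex.Re (u n)).
    by apply/funext => n; rewrite /series/= (@raddf_sum _ _ (@complex.Re R : Rcomplex R -> R)).
  exact: hre.
have -> : (fun n => complex.Im (series u n)) = series (fun n => complex.Im (u n)).
  by apply/funext => n; rewrite /series/= (@raddf_sum _ _ (@complex.Im R : Rcomplex R -> R)).
exact: him.
Qed.

Lemma cvg_realC (v : nat -> R) (l : R) : v @ \oo --> l ->
  ((v n)%:C : R[i]^o) @[n --> \oo] --> (l%:C : R[i]^o).
Proof. by move=> h; apply: cvg_complex => //=; exact: cvg_cst. Qed.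

End ComplexSeries.

Definition disk (R : realType) := {z : R[i] | `|z| < 1}.

Section SquareSummable.
Context {R : realType} {D : hilbertType R}.
Implicit Types (a b : nat -> D) (z : R[i]).

Definition square_summable a := cvgn (series (fun n => rnorm (a n) ^+ 2)).

Definition power_series a z : nat -> D := series (fun n => z ^+ n *: a n).

Lemma square_summableP a : square_summable a <->
  exists M : R, forall N, \sum_(0 <= k < N) rnorm (a k) ^+ 2 <= M.
Proof.
split=> [h|[M h]].
  exists (limn (series (fun n => rnorm (a n) ^+ 2))) => N.
  have := @nondecreasing_cvgn_le R (series (fun n => rnorm (a n) ^+ 2)).
  apply=> //; apply/nondecreasing_seqP => n.
  by rewrite seriesSr lerDl sqr_ge0.
apply: nondecreasing_is_cvgn.
  by apply/nondecreasing_seqP => n; rewrite seriesSr lerDl sqr_ge0.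
by exists M => _ [n _ <-]; exact: h.
Qed.

Lemma square_summableB a b : square_summable a -> square_summable b ->
  forall c : R[i], square_summable (fun n => c *: a n + b n).
Proof.
move=> ha hb c.
have hc : cvgn (series (fun n => 2 * complex.Re `|c| ^+ 2 * rnorm (a n) ^+ 2 +
    2 * rnorm (b n) ^+ 2)).
  have -> : series (fun n => 2 * complex.Re `|c| ^+ 2 * rnorm (a n) ^+ 2 +
      2 * rnorm (b n) ^+ 2) = (fun n => 2 * complex.Re `|c| ^+ 2 *
      series (fun n => rnorm (a n) ^+ 2) n +
      2 * series (fun n => rnorm (b n) ^+ 2) n).
    by apply/funext => n; rewrite /series/= big_split/= !mulr_sumr.
  by apply: is_cvgD; apply: is_cvgMr.
apply: series_le_cvg hc => [n|n|n].
- by rewrite sqr_ge0.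
- by rewrite addr_ge0// !mulr_ge0// ?exprn_ge0 ?sqr_ge0// -ler0c RRe_real ?normr_real.
- apply: (@le_trans _ _ ((rnorm (c *: a n) + rnorm (b n)) ^+ 2)).
    by rewrite ler_pXn2r ?nnegrE ?addr_ge0 ?rnorm_ge0// rnormD.
  rewrite rnormZ; set p := complex.Re `|c|; set q := rnorm (a n).
  set r := rnorm (b n).
  have := sqr_ge0 (p * q - r); lra.
Qed.

Lemma square_summable_bound a : square_summable a ->
  exists2 M : R, 0 <= M & forall n, rnorm (a n) <= M.
Proof.
move=> /square_summableP[M h].
have M0 : 0 <= M by rewrite (le_trans _ (h 0%N))// big_geq.
exists (Num.sqrt M) => [|n]; first exact: sqrtr_ge0.
rewrite -(@ler_pXn2r _ 2)// ?nnegrE ?sqrtr_ge0 ?rnorm_ge0// sqr_sqrtr//.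
rewrite (le_trans _ (h n.+1))// big_nat_recr//= lerDr.
by rewrite sumr_ge0// => i _; rewrite sqr_ge0.
Qed.

Lemma power_series_cvg a z : square_summable a -> `|z| < 1 ->
  cvgn (power_series a z).
Proof.
move=> /square_summable_bound[M M0 aM] z1; apply: rnormed_cvg.
have zr : complex.Re `|z| < 1 by rewrite -ltcR RRe_real ?normr_real.
have z0 : 0 <= complex.Re `|z| by rewrite -ler0c RRe_real ?normr_real.
have : cvgn (series (geometric M (complex.Re `|z|))).
  by apply: is_cvg_geometric_series; rewrite ger0_norm.
apply: series_le_cvg => n.
- exact: rnorm_ge0.
- by rewrite /= mulr_ge0// exprn_ge0.
- have zX : complex.Re `|z ^+ n| = complex.Re `|z| ^+ n.
    apply: complexI; rewrite -/(real_complex R) RRe_real ?normr_real// normrX.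
    by rewrite -{1}(RRe_real (normr_real z)) rmorphXn.
  by rewrite rnormZ zX /= mulrC ler_wpM2r// exprn_ge0.
Qed.

Lemma power_series_eq0 a : square_summable a ->
  (forall z, `|z| < 1 -> power_series a z @ \oo --> (0 : D)) ->
  forall n, a n = 0.
Proof.
move=> /square_summable_bound[M M0 aM] h n.
elim/ltn_ind : n => k IH; apply: rnorm_eq0; apply/eqP.
rewrite eq_le rnorm_ge0 andbT; apply/ler_addgt0Pr => e e0; rewrite add0r.
pose t : R := Num.min (2^-1) (e / (2 * M + 1)).
have M1 : 0 < 2 * M + 1 by rewrite ltr_wpDl// mulr_ge0.
have t0 : 0 < t by rewrite lt_min invr_gt0 ltr0n/= divr_gt0.
have t2 : t <= 2^-1 by rewrite ge_min lexx.
have te : 2 * M * t <= e.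
  have : t <= e / (2 * M + 1) by rewrite ge_min lexx orbT.
  by rewrite ler_pdivlMr// => ?; nra.
have nt : `|t%:C| = t%:C by rewrite ger0_norm// ler0c ltW.
have t1 : `|t%:C| < 1 by rewrite nt (_ : 1 = 1%:C)// ltcR; lra.
have ht := h _ t1.
have geo m :
    \sum_(k.+1 <= i < k.+1 + m) t ^+ i <= 2 * t ^+ k.+1 - 2 * t ^+ (k.+1 + m).
  elim: m => [|m IHm]; first by rewrite addn0 big_geq// subrr.
  rewrite addnS big_nat_recr/= ?leq_addr// [t ^+ (k.+1 + m).+1]exprS.
  have : 0 <= t ^+ (k.+1 + m) by rewrite exprn_ge0 ?ltW.
  move: IHm; set p := t ^+ (k.+1 + m); set q := \sum_(_ <= _ < _) _.
  by move: (t ^+ k.+1) => r; nra.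
have bnd N : (k < N)%N ->
    t ^+ k * rnorm (a k) <= rnorm (power_series a t%:C N) + 2 * M * t ^+ k.+1.
  move=> kN.
  have rt i x : rnorm (t%:C ^+ i *: x : D) = t ^+ i * rnorm x.
    by rewrite rnormZ normrX nt -rmorphXn.
  rewrite -rt /power_series /series/= (big_cat_nat (n := k))//=; last exact: ltnW.
  rewrite big_nat big1 ?add0r; last by move=> i /andP[_ ik]; rewrite IH// scaler0.
  rewrite big_ltn//; set s := \sum_(_ <= _ < _) _.
  have -> : t%:C ^+ k *: a k = (t%:C ^+ k *: a k + s) - s by rewrite addrK.
  rewrite (le_trans (rnormD _ _))// addrK rnormN lerD2l /s.
  rewrite (le_trans (rnorm_sum _ _ _))//.
  apply: (@le_trans _ _ (\sum_(k.+1 <= i < N) M * t ^+ i)).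
    by apply: ler_sum => i _; rewrite rt mulrC ler_wpM2r ?exprn_ge0 ?(ltW t0).
  rewrite -mulr_sumr -(subnKC kN) [2 * M]mulrC -mulrA ler_wpM2l//.
  by apply: (le_trans (geo _)); rewrite gerBl mulr_ge0// exprn_ge0// ltW.
have lim0 : t ^+ k * rnorm (a k) <= 2 * M * t ^+ k.+1.
  have c1 : rnorm (power_series a t%:C N) + 2 * M * t ^+ k.+1 @[N --> \oo] -->
      2 * M * t ^+ k.+1.
    rewrite -[X in _ --> X]add0r -(@rnorm0 _ D).
    by apply: cvgD; [exact: cvg_rnorm|exact: cvg_cst].
  apply: (ler_cvg_to (cvg_cst _) c1); near=> m.
  by apply: bnd; near: m; exact: nbhs_infty_gt.
rewrite (le_trans _ te)//.
by move: lim0; rewrite exprSr mulrCA ler_pM2l// exprn_gt0.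
Unshelve. all: by end_near. Qed.

End SquareSummable.

Section HardyType.
Context {R : realType} {D : hilbertType R}.

Definition is_hardy (f : disk R -> D) :=
  exists2 a : nat -> D, square_summable a &
    forall z, power_series a (val z) @ \oo --> f z.

Definition hardy_pred : {pred disk R -> D} := fun f => `[< is_hardy f >].

Lemma cvg_power_series_lin (a b : nat -> D) (c z : R[i]) (u v : D) :
  power_series a z @ \oo --> u -> power_series b z @ \oo --> v ->
  power_series (fun n => c *: a n + b n) z @ \oo --> c *: u + v.
Proof.
move=> au bv.
have -> : power_series (fun n => c *: a n + b n) z =
    (fun n => c *: power_series a z n + power_series b z n).
  apply/funext => n; rewrite /power_series /series/= scaler_sumr -big_split/=.
  by apply: eq_bigr => i _; rewrite scalerDr !scalerA mulrC.
by apply: cvgD => //; exact: cvgZr.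
Qed.

Lemma hardy_submod_closed : submod_closed hardy_pred.
Proof.
split=> [|c f g /asboolP[a ha af] /asboolP[b hb bg]].
  apply/asboolP; exists (fun=> 0) => [|z].
    by apply/square_summableP; exists 0 => N; rewrite big1// => i _; rewrite rnorm0 expr0n.
  have -> : power_series (fun=> 0 : D) (val z) = (fun=> 0).
    by apply/funext => n; rewrite /power_series /series/= big1// => i _; rewrite scaler0.
  exact: cvg_cst.
apply/asboolP; exists (fun n => c *: a n + b n) => [|z].
  exact: square_summableB.
exact: cvg_power_series_lin.
Qed.

HB.instance Definition _ :=
  GRing.isSubmodClosed.Build R[i] (disk R -> D) hardy_pred hardy_submod_closed.

End HardyType.

Record hardy {R : realType} (D : hilbertType R) := Hardy {
  hardy_fun :> disk R -> D ;
  hardy_subproof : hardy_fun \in hardy_pred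
}.

HB.instance Definition _ (R : realType) (D : hilbertType R) :=
  [isSub for @hardy_fun R D].
HB.instance Definition _ (R : realType) (D : hilbertType R) :=
  [Choice of hardy D by <:].
HB.instance Definition _ (R : realType) (D : hilbertType R) :=
  [SubChoice_isSubLmodule of hardy D by <:].

Section HardyTheory.
Context {R : realType} {D : hilbertType R}.
Implicit Types (f g : hardy D) (a b : nat -> D).

Definition is_coef f a := square_summable a /\
  forall z : disk R, power_series a (val z) @ \oo --> f z.

(* The Taylor coefficients of [f] at 0. *)
Definition hardy_coef f : nat -> D := xget (fun=> 0) (is_coef f).

Lemma coefP f : is_coef f (hardy_coef f).
Proof.
rewrite /hardy_coef; case: xgetP => [a _ //|h].
by have /asboolP[a ha haf] := hardy_subproof f; have := h a (conj ha haf).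
Qed.

Lemma coef_unique f a : is_coef f a -> hardy_coef f = a.
Proof.
move=> [ha af]; have [hc cf] := coefP f.
have hca : square_summable (fun n => (-1) *: a n + hardy_coef f n).
  exact: square_summableB.
have h0 z : `|z| < 1 -> power_series (fun n => -1 *: a n + hardy_coef f n) z @ \oo --> (0 : D).
  move=> z1; pose w : disk R := Sub z z1.
  have -> : 0 = -1 *: f w + f w by rewrite scaleN1r addNr.
  by apply: cvg_power_series_lin; [exact: (af w)|exact: (cf w)].
have h1 := power_series_eq0 hca h0.
by apply/funext => n; have /eqP := h1 n; rewrite scaleN1r addrC subr_eq0 => /eqP.
Qed.

Lemma coef_lin (c : R[i]) f g n : hardy_coef (c *: f + g) n = c *: hardy_coef f n + hardy_coef g n.
Proof.
suff -> : hardy_coef (c *: f + g) = (fun n => c *: hardy_coef f n + hardy_coef g n) by [].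
apply: coef_unique; split.
  by apply: square_summableB; exact: (coefP _).1.
by move=> z; apply: cvg_power_series_lin; exact: (coefP _).2.
Qed.

Lemma coef0 n : hardy_coef 0 n = 0.
Proof.
have := coef_lin (-1) 0 0 n; rewrite scaleN1r oppr0 addr0 => ->.
by rewrite scaleN1r addNr.
Qed.

Lemma coefB f g n : hardy_coef (f - g) n = hardy_coef f n - hardy_coef g n.
Proof. by rewrite addrC -scaleN1r coef_lin scaleN1r addrC. Qed.

Lemma coef_eq0 f : (forall n, hardy_coef f n = 0) -> f = 0.
Proof.
move=> h; apply/val_inj/funext => z.
have := (coefP f).2 z.
have -> : power_series (hardy_coef f) (val z) = (fun=> 0).
  by apply/funext => n; rewrite /power_series /series/= big1// => i _; rewrite h scaler0.
move=> /(cvg_lim (@norm_hausdorff _ _)) /= <-.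
by apply: cvg_lim => //; exact: cvg_cst.
Qed.

Lemma hardy_of_subproof a : square_summable a ->
  (fun z : disk R => limn (power_series a (val z))) \in (@hardy_pred R D).
Proof.
move=> ha; apply/asboolP; exists a => // z.
exact: power_series_cvg ha (valP z).
Qed.

Definition hardy_of a (ha : square_summable a) : hardy D :=
  Hardy (hardy_of_subproof ha).

Lemma coef_hardy_of a (ha : square_summable a) : hardy_coef (hardy_of ha) = a.
Proof.
apply: coef_unique; split => // z.
exact: power_series_cvg ha (valP z).
Qed.

Definition hardy_dot f g : R[i] :=
  limn (series (fun n => '[hardy_coef f n, hardy_coef g n]) : nat -> R[i]^o).

Lemma hardy_dot_cvg f g :
  (series (fun n => '[hardy_coef f n, hardy_coef g n]) : nat -> R[i]^o) @ \oo -->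
  (hardy_dot f g : R[i]^o).
Proof.
have hf := (coefP f).1; have hg := (coefP g).1.
have hc : cvgn (series (fun n => rnorm (hardy_coef f n) ^+ 2 + rnorm (hardy_coef g n) ^+ 2)).
  have -> : series (fun n => rnorm (hardy_coef f n) ^+ 2 + rnorm (hardy_coef g n) ^+ 2) =
    series (fun n => rnorm (hardy_coef f n) ^+ 2) \+ series (fun n => rnorm (hardy_coef g n) ^+ 2).
    by apply/funext => n; rewrite /series/= big_split.
  exact: is_cvgD.
apply: cvg_series_complex hc => n.
rewrite (le_trans (hCauchySchwarz _ _))// !rnormE -rmorphM lecR.
have := sqr_ge0 (rnorm (hardy_coef f n) - rnorm (hardy_coef g n)).
have := sqr_ge0 (rnorm (hardy_coef f n)); have := sqr_ge0 (rnorm (hardy_coef g n)); nra.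
Qed.

Arguments hardy_dot_cvg : clear implicits.

Lemma hardy_dotC f g : hardy_dot f g = (hardy_dot g f)^*%C.
Proof.
rewrite [LHS]/hardy_dot; apply: (cvg_lim (@norm_hausdorff _ R[i]^o)).
have /cvg_rnormP h := @hardy_dot_cvg g f.
apply/cvg_rnormP => e /h; apply: filterS => n.
have -> : series (fun n => '[hardy_coef f n, hardy_coef g n]) n =
    (series (fun n => '[hardy_coef g n, hardy_coef f n]) n)^*%C.
  by rewrite /series/= rmorph_sum/=; apply: eq_bigr => i _; rewrite dotC.
have hn (x : R[i]) : rnorm (x^*%C : R[i]^o) = rnorm (x : R[i]^o).
  by congr complex.Re; exact: normcJ.
by rewrite -rmorphB/= hn.
Qed.

Lemma hardy_dotl (c : R[i]) f f' g :
  hardy_dot (c *: f + f') g = c * hardy_dot f g + hardy_dot f' g.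
Proof.
rewrite [LHS]/hardy_dot; apply: (cvg_lim (@norm_hausdorff _ R[i]^o)).
have -> : series (fun n => '[hardy_coef (c *: f + f') n, hardy_coef g n]) =
  (fun n => (c : R[i]) *: (series (fun n => '[hardy_coef f n, hardy_coef g n]) n : R[i]^o) +
    series (fun n => '[hardy_coef f' n, hardy_coef g n]) n).
  apply/funext => n; rewrite /series/= scaler_sumr -big_split/=.
  by apply: eq_bigr => i _; rewrite coef_lin linearPl.
by apply: cvgD; [apply: cvgZr; exact: hardy_dot_cvg|exact: hardy_dot_cvg].
Qed.

Lemma hardy_dotE f : hardy_dot f f = (limn (series (fun n => rnorm (hardy_coef f n) ^+ 2)))%:C.
Proof.
rewrite [LHS]/hardy_dot; apply: (cvg_lim (@norm_hausdorff _ R[i]^o)).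
have -> : (series (fun n => '[hardy_coef f n, hardy_coef f n]) : nat -> R[i]^o) =
    (fun n => (series (fun n => rnorm (hardy_coef f n) ^+ 2) n)%:C).
  apply/funext => n; rewrite /series/= rmorph_sum/=.
  by apply: eq_bigr => i _; rewrite -hnormE rnormE rmorphXn.
by apply: cvg_realC; exact: (coefP f).1.
Qed.

Lemma coef_le_dot f N : \sum_(0 <= n < N) rnorm (hardy_coef f n) ^+ 2 <=
  limn (series (fun n => rnorm (hardy_coef f n) ^+ 2)).
Proof.
apply: (@nondecreasing_cvgn_le R (series (fun n => rnorm (hardy_coef f n) ^+ 2))).
  by apply/nondecreasing_seqP => n; rewrite seriesSr lerDl sqr_ge0.
exact: (coefP f).1.
Qed.

Lemma hardy_dot_gt0 f : f != 0 -> 0 < hardy_dot f f.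
Proof.
move=> f0; rewrite hardy_dotE -[0]/(0%:C) ltcR; set l := limn _.
have l0 : 0 <= l by have := coef_le_dot f 0; rewrite big_geq.
rewrite lt_def l0 andbT; apply: contra f0 => /eqP l00; apply/eqP/coef_eq0 => n.
apply: rnorm_eq0; apply/eqP; rewrite -sqrf_eq0 eq_le sqr_ge0 andbT -l00.
rewrite (le_trans _ (coef_le_dot f n.+1))// big_nat_recr//= lerDr.
by rewrite sumr_ge0// => i _; rewrite sqr_ge0.
Qed.

End HardyTheory.

Section HardyDot.
Context {R : realType} {D : hilbertType R}.

Lemma hardy_dot_bilinear :
  bilinear_for *%R (Num.conj \; *%R) (@hardy_dot R D : hardy D -> hardy D -> R[i]).
Proof.
split=> [g c f f'|f c g g'] /=; first exact: hardy_dotl.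
rewrite ![hardy_dot f _]hardy_dotC hardy_dotl rmorphD rmorphM/=.
by congr (_ + _).
Qed.

HB.instance Definition _ := bilinear_isBilinear.Build R[i] (hardy D) (hardy D)
  R[i] *%R (Num.conj \; *%R) (@hardy_dot R D) hardy_dot_bilinear.

Lemma hardy_dot_hermitian (f g : hardy D) :
  hardy_dot f g = (-1) ^+ false * Num.conj (hardy_dot g f).
Proof. by rewrite expr0 mul1r hardy_dotC. Qed.

HB.instance Definition _ := isHermitianSesquilinear.Build R[i] (hardy D) false
  Num.conj (@hardy_dot R D) hardy_dot_hermitian.

HB.instance Definition _ := isDotProduct.Build R[i] (hardy D) (@hardy_dot R D)
  (@hardy_dot_gt0 R D).

Definition hardy_norm (f : hardy D) : R[i] := sqrtC (hardy_dot f f).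

Lemma hardy_normD f g : hardy_norm (f + g) <= hardy_norm f + hardy_norm g.
Proof. exact: dot_triangle. Qed.

Lemma hardy_normZ (c : R[i]) f : hardy_norm (c *: f) = `|c| * hardy_norm f.
Proof.
rewrite /hardy_norm (dnormZ (@hardy_dot R D : {dot hardy D for Num.conj})).
by rewrite sqrtCM ?nnegrE ?exprn_ge0// ?dnorm_ge0// sqrCK.
Qed.

Lemma hardy_norm_eq0 f : hardy_norm f = 0 -> f = 0.
Proof. by move=> /eqP; rewrite sqrtC_eq0 dnorm_eq0 => /eqP. Qed.

End HardyDot.

HB.instance Definition _ (R : realType) (D : hilbertType R) :=
  Lmodule_isNormed.Build R[i] (hardy D)
    (@hardy_normD R D) (@hardy_normZ R D) (@hardy_norm_eq0 R D).

Section HardyHilbert.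
Context {R : realType} {D : hilbertType R}.
Implicit Types f g : hardy D.

Lemma hardy_rnormE f :
  rnorm f ^+ 2 = limn (series (fun n => rnorm (hardy_coef f n) ^+ 2)).
Proof.
apply: complexI; rewrite -hardy_dotE -/(real_complex R) rmorphXn/= -rnormE.
by rewrite -[`|f|]/(hardy_norm f) sqrtCK.
Qed.

Lemma rnorm_hardy_le f (M : R) : 0 <= M ->
  (forall N, \sum_(0 <= n < N) rnorm (hardy_coef f n) ^+ 2 <= M ^+ 2) -> rnorm f <= M.
Proof.
move=> M0 h; rewrite -(@ler_pXn2r _ 2)// ?nnegrE ?rnorm_ge0// hardy_rnormE.
by apply: limr_le; [exact: (coefP f).1|exact: nearW].
Qed.

Lemma sum_coef_le f N : \sum_(0 <= n < N) rnorm (hardy_coef f n) ^+ 2 <= rnorm f ^+ 2.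
Proof. by rewrite hardy_rnormE coef_le_dot. Qed.

Lemma coef_le f n : rnorm (hardy_coef f n) <= rnorm f.
Proof.
rewrite -(@ler_pXn2r _ 2)// ?nnegrE ?rnorm_ge0//.
rewrite (le_trans _ (sum_coef_le f n.+1))// big_nat_recr//= lerDr.
by rewrite sumr_ge0// => i _; rewrite sqr_ge0.
Qed.

Lemma hardy_complete (F : set_system (hardy D)) :
  ProperFilter F -> cauchy F -> cvg F.
Proof.
move=> FF /cauchy_ballP Fc.
have Fc' (e : R) : 0 < e -> \forall f & g \near F, rnorm (f - g) < e.
  move=> e0; have e0' : 0 < e%:C by rewrite ltcR.
  have := Fc _ e0'; apply: filterS => -[f g] /=.
  by rewrite -ball_normE/= rnormE ltcR.
have cc n : cvg ((fun f => hardy_coef f n) @ F).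
  apply/cauchy_cvgP/cauchy_exP => e e0.
  have [f hf] := filter_ex (nearP_dep (Fc _ e0)).
  exists (hardy_coef f n); apply: filterS hf => g /=.
  rewrite -!ball_normE/= => h; apply: le_lt_trans h.
  by rewrite -coefB !rnormE lecR coef_le.
pose b n := lim ((fun f => hardy_coef f n) @ F).
have bE n : hardy_coef f n @[f --> F] --> b n by exact: cc.
have key (e : R) : 0 < e -> \forall f \near F, forall N,
    \sum_(0 <= n < N) rnorm (hardy_coef f n - b n) ^+ 2 <= e ^+ 2.
  move=> e0; apply: filterS (nearP_dep (Fc' _ e0)) => f fe N.
  have h : \sum_(0 <= n < N) rnorm (hardy_coef f n - hardy_coef g n) ^+ 2 @[g --> F] -->
      \sum_(0 <= n < N) rnorm (hardy_coef f n - b n) ^+ 2.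
    elim: N => [|N IHN].
      by under eq_fun do rewrite big_geq//; rewrite big_geq//; exact: cvg_cst.
    under eq_fun do rewrite big_nat_recr//=; rewrite big_nat_recr//=.
    apply: cvgD => //; under eq_fun do rewrite expr2; rewrite expr2.
    by apply: cvgM; apply: cvg_rnorm; apply: cvgB => //; exact: cvg_cst.
  apply: (ler_cvg_to h (cvg_cst (e ^+ 2))); apply: filterS fe => g fg.
  under eq_bigr do rewrite -coefB.
  rewrite (le_trans (sum_coef_le _ _))// ler_pXn2r ?nnegrE ?rnorm_ge0 ?(ltW e0)//.
  exact: ltW.
have hb : square_summable b.
  have [f hf] := filter_ex (key 1 ltr01).
  have hfb : square_summable (fun n => hardy_coef f n - b n).
    by apply/square_summableP; exists (1 ^+ 2).
  have -> : b = (fun n => -1 *: (hardy_coef f n - b n) + hardy_coef f n).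
    by apply/funext => n; rewrite scaleN1r opprB subrK.
  by apply: square_summableB => //; exact: (coefP f).1.
apply/cvg_ex; exists (hardy_of hb); apply/cvg_rnormP => e e0.
have e20 : 0 < e / 2 by rewrite divr_gt0.
apply: filterS (key _ e20) => f hf.
rewrite rnormB (@le_lt_trans _ _ (e / 2))//; last lra.
apply: rnorm_hardy_le => [|N]; first exact: ltW.
by under eq_bigr do rewrite coefB coef_hardy_of.
Qed.

HB.instance Definition _ := Uniform_isComplete.Build (hardy D) hardy_complete.

Lemma hardy_normE f : `|f| ^+ 2 = hardy_dot f f.
Proof. by rewrite -[`|f|]/(hardy_norm f) sqrtCK. Qed.

HB.instance Definition _ := isHilbert.Build R (hardy D) hardy_normE.

(* The operator M_z, multiplication by the coordinate function. *)
Lemma shift_subproof f : (fun z : disk R => val z *: f z) \in (@hardy_pred R D).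
Proof.
have [ha af] := coefP f.
apply/asboolP; exists (fun n => if n is m.+1 then hardy_coef f m else 0) => [|z].
  apply/square_summableP; exists (rnorm f ^+ 2) => -[|N].
    by rewrite big_geq// sqr_ge0.
  by rewrite big_nat_recl//= rnorm0 expr0n/= add0r sum_coef_le.
rewrite -(cvg_shiftn 1)/=.
have -> : (fun n => power_series (fun n => if n is m.+1 then hardy_coef f m else 0)
    (val z) (n + 1)%N) = (fun n => val z *: power_series (hardy_coef f) (val z) n).
  apply/funext => n; rewrite /power_series /series/= addn1 big_nat_recl//=.
  rewrite scaler0 add0r scaler_sumr.
  by apply: eq_bigr => i _; rewrite scalerA exprS.
by apply: cvgZr; exact: af.
Qed.

Definition hardy_shift f : hardy D := Hardy (shift_subproof f).

End HardyHilbert.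

(* Main.v *)
(** Let P be the orthogonal projection onto S and Q = P T^*. Invariance of S
    gives Q P = Q and Q^m P = P T^*^m, so Q^m -> 0 strongly. If A satisfies
    |A x|^2 = |x|^2 - |Q x|^2, then L x = sum_m (A Q^m x) z^m is isometric by
    telescoping and intertwines Q with the backward shift; Pi is the adjoint of
    L P. Instead of the square root of 1 - Q^* Q, the operator A is built with
    values in the Hilbert space H^2_H of square-summable sequences: if w is the
    orbit of x under Q, Q^*, Q, Q^*, ..., the second differences of |w_n|^2 are
    the |w_n - w_(n+2)|^2, and they sum to |x|^2 - |Q x|^2. *)
Require Import Defs.
From HB Require Import structures.
From mathcomp Require Import all_boot all_order all_algebra.
From mathcomp Require Import complex.
From mathcomp Require Import sesquilinear interval_inference ring lra.
From mathcomp Require Import all_classical reals topology normedtype sequences.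

Set Implicit Arguments.
Unset Strict Implicit.
Unset Printing Implicit Defensive.

Import Order.TTheory GRing.Theory Num.Theory.
Import numFieldNormedType.Exports.

Local Open Scope classical_set_scope.
Local Open Scope ring_scope.
Local Open Scope complex_scope.

(** * Linear maps, adjoints and contractions *)

Lemma ex_linear (C : pzRingType) (U V : lmodType C) (f : U -> V) :
  linear f -> exists g : {linear U -> V}, forall x, g x = f x.
Proof.
move=> fL.
pose F := GRing.isLinear.Build C U V *:%R f fL.
pose g : {linear U -> V} := HB.pack f F.
by exists g.
Qed.

Section Operators.
Context {R : realType}.

Lemma hdot_injl (H : hilbertType R) (x y : H) :
  (forall w, '[x, w] = '[y, w]) -> x = y.
Proof. by move=> h; apply: hdot_inj => w; rewrite dotC h -dotC. Qed.

Lemma ex_adjoint (H K : hilbertType R) (T : {linear H -> K}) :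
  bounded_operator T ->
  exists T' : {linear K -> H}, forall x y, '[T x, y] = '[x, T' y].
Proof.
move=> bT; have TP := adjointP bT.
have [T' T'E] : exists g : {linear K -> H}, forall y, g y = adjoint T y.
  apply: ex_linear => a u v; apply: hdot_inj => w.
  by rewrite -TP !linearD/= !linearZr_LR/= !TP.
by exists T' => x y; rewrite T'E TP.
Qed.

Lemma contractiveP (H K : hilbertType R) (T : H -> K) :
  contractive T <-> forall x, rnorm (T x) <= rnorm x.
Proof.
split=> h x; first by rewrite -lecR -!rnormE; exact: h.
by rewrite !rnormE lecR.
Qed.

Lemma contractive_bounded (H K : hilbertType R) (T : H -> K) :
  contractive T -> bounded_operator T.
Proof. by move=> h; exists 1 => x; rewrite mul1r. Qed.

Lemma adjoint_contractive (H K : hilbertType R) (T : H -> K) (T' : K -> H) :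
  contractive T -> (forall x y, '[T x, y] = '[x, T' y]) -> contractive T'.
Proof.
move=> /contractiveP cT TT'; apply/contractiveP => y.
rewrite -(@ler_pXn2r _ 2) ?nnegrE ?rnorm_ge0//.
have h : rnorm (T' y) ^+ 2 <= rnorm (T' y) * rnorm y.
  rewrite rnorm_sqr -TT' (le_trans (ler_norm _))// (le_trans (Re_dot_le _ _))//.
  by rewrite ler_wpM2r ?rnorm_ge0.
(* With a = [rnorm (T' y)] and b = [rnorm y], a^2 <= ab <= (a^2 + b^2)/2 gives a^2 <= b^2 without
   dividing by a, which may vanish. *)
by have := sqr_ge0 (rnorm (T' y) - rnorm y); lra.
Qed.

(** Expanding the norm at x + y recovers the real part of the inner product; replacing x by ix
    recovers the imaginary part. *)
Lemma polarization (H K L : hilbertType R) (V : {linear H -> K})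
    (W : {linear H -> L}) :
  (forall x, rnorm (V x) = rnorm (W x)) -> forall x y, '[V x, V y] = '[W x, W y].
Proof.
move=> VW.
have re x y : complex.Re '[V x, V y] = complex.Re '[W x, W y].
  have := VW (x + y); rewrite !linearD/= => /(congr1 (fun r => r ^+ 2)).
  by rewrite !rnorm_sqrD !VW => /addrI; lra.
move=> x y; have h1 := re x y; have h2 := re ('i%C *: x) y; move: h1 h2.
rewrite !linearZ/= !linearZl_LR/=.
case: '[V x, V y] => u v; case: '[W x, W y] => u' v' /= -> /=.
by rewrite !mul0r !mul1r !sub0r => /oppr_inj ->.
Qed.

End Operators.

(** * Orthogonal projection onto a closed subspace *)

Section Projection.
Context {R : realType} {H : hilbertType R}.

Lemma closed_subspace0 (S : set H) : closed_subspace S -> S 0.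
Proof. by move=> [_ [S0 _]]; rewrite -in_setE. Qed.

Lemma closed_subspace_lin (S : set H) : closed_subspace S ->
  forall (a : R[i]) u v, S u -> S v -> S (a *: u + v).
Proof.
by move=> [_ [_ SL]] a u v Su Sv; have := SL a u v; rewrite !in_setE; apply.
Qed.

Lemma parallelogram (x y : H) :
  rnorm (x + y) ^+ 2 + rnorm (x - y) ^+ 2 = 2 * rnorm x ^+ 2 + 2 * rnorm y ^+ 2.
Proof.
by rewrite !rnorm_sqrD rnormN linearNr/= raddfN/=; ring.
Qed.

(** A minimizing sequence in [S] is Cauchy by the parallelogram law, and its limit stays in [S] by
    closedness. *)
Lemma ex_nearest (S : set H) (x : H) : closed_subspace S ->
  exists2 p, S p & forall s, S s -> rnorm (x - p) <= rnorm (x - s).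
Proof.
move=> hS; have [clS _] := hS; have S0 := closed_subspace0 hS.
have SD := closed_subspace_lin hS.
pose J s := rnorm (x - s) ^+ 2.
pose d := inf (J @` S).
have hd : has_inf (J @` S).
  split; first by exists (J 0), 0.
  by exists 0 => _ [s _ <-]; exact: sqr_ge0.
have dJ s : S s -> d <= J s by move=> Ss; apply: ge_inf; [exact: hd.2|exists s].
have /choice[s_ sP] (n : nat) : exists s, S s /\ J s < d + n.+1%:R^-1.
  have [|_ [s Ss <-] hs] := @inf_adherent _ _ n.+1%:R^-1 _ hd.
    by rewrite invr_gt0 ltr0n.
  by exists s.
(* The vectors x - s and x - t add up to twice x - m, where m is the midpoint of s and t; m lies in
   [S], so [J] is at least [d] there. *)
have par s t : S s -> S t -> rnorm (s - t) ^+ 2 <= 2 * (J s + J t) - 4 * d.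
  move=> Ss St.
  have := dJ ((2^-1)%:C *: s + (2^-1)%:C *: t).
  have Sh : S ((2^-1)%:C *: t).
    by rewrite -[_ *: _]addr0; exact: SD.
  move=> /(_ (SD _ _ _ Ss Sh)).
  have := parallelogram (x - s) (x - t).
  have -> : (x - s) - (x - t) = t - s by rewrite opprB addrC addrA subrK.
  have -> : (x - s) + (x - t) = 2%:C *: (x - ((2^-1)%:C *: s + (2^-1)%:C *: t)).
    rewrite scalerBr scalerDr !scalerA -rmorphM/= divff ?pnatr_eq0// !scale1r.
    by rewrite opprD addrACA (rmorph_nat (real_complex R) 2) scaler_nat mulr2n.
  rewrite rnormZr -/(J _) -[rnorm (x - s) ^+ 2]/(J s) -[rnorm (x - t) ^+ 2]/(J t).
  rewrite rnormB; move: (rnorm _ ^+ 2) (J _) (J _) (J _) => *; lra.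
have cs : cvgn s_.
  apply/cauchy_cvgP/cauchy_exP => e e0.
  have eE : e = (complex.Re e)%:C by rewrite RRe_real// gtr0_real.
  move: e0; rewrite eE ltcR; set c := complex.Re e => c0.
  (* By [par], two excesses over [d], each below c^2/4, bound the squared distance by 2(c^2/4 +
     c^2/4) = c^2. *)
  have c20 : 0 < c ^+ 2 / 4 by rewrite divr_gt0 ?exprn_gt0.
  have [N _ NP] := near_infty_natSinv_lt (PosNum c20).
  exists (s_ N); exists N => // n /= Nn; rewrite -ball_normE/= rnormE ltcR.
  rewrite -(@ltr_pXn2r _ 2)// ?nnegrE ?rnorm_ge0 ?(ltW c0)//.
  rewrite (le_lt_trans (par _ _ (sP _).1 (sP _).1))//.
  have := NP n Nn; have := NP N (leqnn N) => /=.
  have := (sP n).2; have := (sP N).2.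
  move: (n.+1%:R^-1 : R) (N.+1%:R^-1 : R) => u v; lra.
have sp : s_ @ \oo --> limn s_ by [].
exists (limn s_).
  by apply: (closed_cvg S clS _ _ sp); apply: nearW => n; exact: (sP n).1.
move=> s Ss; rewrite -(@ler_pXn2r _ 2) ?nnegrE ?rnorm_ge0//.
apply: le_trans (dJ _ Ss).
have h1 : J (s_ n) @[n --> \oo] --> J (limn s_).
  rewrite /J; under eq_fun do rewrite expr2; rewrite expr2.
  by apply: cvgM; apply: cvg_rnorm; apply: cvgB => //; exact: cvg_cst.
have h2 : d + n.+1%:R^-1 @[n --> \oo] --> d.
  rewrite -[X in _ --> X]addr0.
  by apply: cvgD; [exact: cvg_cst|exact: cvg_harmonic].
by apply: (ler_cvg_to h1 h2); apply: nearW => n; apply: ltW; exact: (sP n).2.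
Qed.

(** First variation at the nearest point p: moving p by ts inside [S] cannot shorten x - p, so the
    linear term in t must vanish. *)
Lemma ex_orthogonal (S : set H) (x : H) : closed_subspace S ->
  exists2 p, S p & forall s, S s -> '[x - p, s] = 0.
Proof.
move=> clS; have [p Sp pP] := ex_nearest x clS.
have SD := closed_subspace_lin clS.
have S0 := closed_subspace0 clS.
have re s : S s -> complex.Re '[s, x - p] = 0.
  move=> Ss; set A := complex.Re _; set B := rnorm s ^+ 2.
  have B1 : 0 < B + 1 by rewrite ltr_wpDl// sqr_ge0.
  have key t : 2 * t * A <= t ^+ 2 * B.
    have := pP (t%:C *: s + p) (SD _ _ _ Ss Sp).
    rewrite -(@ler_pXn2r _ 2) ?nnegrE ?rnorm_ge0//.
    have -> : x - (t%:C *: s + p) = (x - p) - t%:C *: s.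
      by rewrite opprD addrCA addrC.
    rewrite [rnorm (x - p - _) ^+ 2]rnorm_sqrD rnormN rnormZr linearNr/= raddfN/=.
    rewrite Re_dotC rdotZ -/A -/B.
    lra.
  (* The optimal t would be A/B; the denominator B + 1 also covers s = 0 and still gives 2A^2(B + 1)
     <= A^2 B, hence A = 0. *)
  have := key (A / (B + 1)).
  rewrite expr_div_n -[_ / _ ^+ 2 * _]mulrAC ler_pdivlMr ?exprn_gt0//.
  have -> : 2 * (A / (B + 1)) * A * (B + 1) ^+ 2 = 2 * A ^+ 2 * (B + 1).
    by field; rewrite gt_eqF.
  have B0 : 0 <= B by rewrite sqr_ge0.
  move=> h; apply/eqP; rewrite -sqrf_eq0 eq_le sqr_ge0 andbT.
  have := sqr_ge0 A; nra.
exists p => // s Ss; rewrite dotC; apply/eqP; rewrite conjC_eq0; apply/eqP.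
have h1 := re s Ss.
have h2 := re ('i%C *: s + 0) (SD _ _ _ Ss S0).
move: h1 h2; rewrite addr0 linearZl_LR/=.
case: '[s, _] => u v /= -> /=.
by rewrite !mul0r !mul1r sub0r => /eqP; rewrite oppr_eq0 => /eqP ->.
Qed.

(** Linearity follows from uniqueness of the orthogonal decomposition; self-adjointness holds
    because both sides equal the inner product of P x and P y. *)
Lemma ex_projection (S : set H) : closed_subspace S ->
  exists P : {linear H -> H}, [/\ forall x, S (P x), forall x, S x -> P x = x
    & forall x y, '[P x, y] = '[x, P y]].
Proof.
move=> clS.
have SD := closed_subspace_lin clS.
have /choice[p pP] x : exists p, S p /\ forall s, S s -> '[x - p, s] = 0.
  by have [p] := ex_orthogonal x clS; exists p.
have p_unique x q : S q -> (forall s, S s -> '[x - q, s] = 0) -> p x = q.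
  move=> Sq qP; have [Sp pP'] := pP x.
  apply/eqP; rewrite -subr_eq0 -(dnorm_eq0 hdot).
  have Spq : S (p x - q) by rewrite addrC -scaleN1r; exact: SD.
  have {1}-> : p x - q = (x - q) - (x - p x) by rewrite opprB [RHS]addrC subrKA.
  by rewrite linearBl/= qP// pP'// subrr.
have [P PE] : exists P : {linear H -> H}, forall x, P x = p x.
  apply: ex_linear => a u v; apply: p_unique => [|s Ss].
    by apply: SD; exact: (pP _).1.
  have -> : a *: u + v - (a *: p u + p v) = a *: (u - p u) + (v - p v).
    by rewrite scalerBr opprD addrACA.
  by rewrite linearPl/= !(pP _).2// mulr0 addr0.
have orth x s : S s -> '[x, s] = '[P x, s].
  by move=> Ss; apply/eqP; rewrite -subr_eq0 -linearBl/= PE (pP x).2.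
exists P; split=> [x|x Sx|x y]; first by rewrite PE; exact: (pP x).1.
  by rewrite PE; apply: p_unique => // s _; rewrite subrr linear0l.
have SP z : S (P z) by rewrite PE; exact: (pP z).1.
by rewrite (orth x)// dotC (orth y)// -dotC.
Qed.

End Projection.

(** * Maps into the Hardy space, the shift and separability *)

Section HardySpace.
Context {R : realType}.

Lemma hardy_coef_inj (D : hilbertType R) (f g : hardy D) :
  hardy_coef f =1 hardy_coef g -> f = g.
Proof.
move=> fg; apply/eqP; rewrite -subr_eq0; apply/eqP; apply: coef_eq0 => n.
by rewrite Defs.coefB fg subrr.
Qed.

(** Builds an operator from its Taylor coefficients: the convergence hypothesis yields both square
    summability and the norm. *)
Lemma ex_hardy_map (H : lmodType R[i]) (D : hilbertType R)
    (a : nat -> H -> D) (M : H -> R) :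
  (forall n, linear (a n)) ->
  (forall x, \sum_(0 <= n < N) rnorm (a n x) ^+ 2 @[N --> \oo] --> M x) ->
  exists L : {linear H -> hardy D},
    (forall x n, hardy_coef (L x) n = a n x) /\
    (forall x, rnorm (L x) ^+ 2 = M x).
Proof.
move=> aL aM.
have asq x : square_summable (a^~ x) by apply/cvg_ex; exists (M x); exact: aM.
have [L LE] : exists L : {linear H -> hardy D}, forall x, L x = hardy_of (asq x).
  apply: ex_linear => c u v; apply: hardy_coef_inj => n.
  by rewrite coef_lin !coef_hardy_of aL.
have LC x n : hardy_coef (L x) n = a n x by rewrite LE coef_hardy_of.
exists L; split=> // x; rewrite hardy_rnormE; apply: cvg_lim => //.
by rewrite (eq_fun (fun n => congr1 (fun y => rnorm y ^+ 2) (LC x n))); exact: aM.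
Qed.

Lemma coef_shift (D : hilbertType R) (f : hardy D) :
  hardy_coef (hardy_shift f) = fun n => if n is m.+1 then hardy_coef f m else 0.
Proof.
apply: coef_unique; split=> [|z].
  apply/square_summableP; exists (rnorm f ^+ 2) => -[|N].
    by rewrite big_geq// sqr_ge0.
  by rewrite big_nat_recl//= rnorm0 expr0n/= add0r sum_coef_le.
rewrite -(cvg_shiftn 1)/=.
have : val z *: power_series (hardy_coef f) (val z) n @[n --> \oo] --> val z *: f z.
  by apply: cvgZr; exact: (coefP f).2.
apply: cvg_trans; apply: near_eq_cvg; apply: nearW => n.
rewrite /power_series /series/= addn1 big_nat_recl//=.
rewrite scaler0 add0r scaler_sumr.
by apply: eq_bigr => i _; rewrite scalerA exprS.
Qed.

(** The adjoint of M_z is the backward shift. Describing [h] by its coefficients avoids constructing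
    that operator. *)
Lemma hardy_dot_shift (D : hilbertType R) (f g h : hardy D) :
  (forall n, hardy_coef h n = hardy_coef g n.+1) ->
  '[hardy_shift f, g] = '[f, h].
Proof.
move=> hg; rewrite -[LHS]/(hardy_dot _ _) -[RHS]/(hardy_dot _ _).
apply: (cvg_lim (@norm_hausdorff _ R[i]^o)).
rewrite -(cvg_shiftn 1)/=.
have := @hardy_dot_cvg _ _ f h; apply: cvg_trans; apply: near_eq_cvg.
apply: nearW => n; rewrite /series/= addn1 big_nat_recl//= coef_shift linear0l add0r.
by apply: eq_bigr => i _; rewrite hg.
Qed.

(** Cut off a tail of squared norm below e^2/4, then move each remaining coefficient into [S]. *)
Lemma hardy_polynomial_approx (D : hilbertType R) (S : set D) (f : hardy D) (e : R) :
  dense S -> 0 < e -> exists s : seq D, (forall x, x \in s -> S x) /\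
    forall g, hardy_coef g =1 nth 0 s -> rnorm (f - g) < e.
Proof.
move=> dS e0.
have e2 : 0 < e ^+ 2 / 4 by rewrite divr_gt0 ?exprn_gt0.
have /cvgrPdist_lt/(_ _ e2)[N _ /(_ N (leqnn N))] := (coefP f).1.
rewrite -hardy_rnormE /series/= => /(le_lt_trans (ler_norm _)) tail.
(* The N head terms contribute at most N d^2 <= e^2/4; [N.+1] keeps the denominator nonzero when N =
   0. *)
pose d := e / (2 * N.+1%:R).
have d0 : 0 < d by rewrite divr_gt0 ?mulr_gt0 ?ltr0n.
have /choice[a aP] i : exists a, S a /\ rnorm (hardy_coef f i - a) < d.
  have dC : 0 < d%:C by rewrite ltcR.
  have [||a [+ Sa]] := dS (ball (hardy_coef f i) d%:C).
  - by exists (hardy_coef f i); exact: ballxx.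
  - exact: ball_open.
  by rewrite -ball_normE/= rnormE ltcR; exists a.
exists (mkseq a N); split=> [x /mapP[i _ ->]|g gs]; first exact: (aP i).1.
(* Bounds on partial sums only give a large inequality for the norm; head and tail total at most
   e^2/2, which leaves room for a strict one. *)
rewrite (@le_lt_trans _ _ (Num.sqrt (e ^+ 2 / 2)))//; last first.
  rewrite -(@ltr_pXn2r _ 2) ?nnegrE ?sqrtr_ge0 ?(ltW e0)// sqr_sqrtr; last lra.
  lra.
apply: rnorm_hardy_le => [|K]; first exact: sqrtr_ge0.
rewrite sqr_sqrtr; last lra.
apply: (@le_trans _ _
  (\sum_(0 <= n < N + K) rnorm (hardy_coef (f - g) n) ^+ 2)).
  rewrite addnC [leRHS](big_cat_nat (n := K))//= ?leq_addr// lerDl.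
  by rewrite sumr_ge0// => i _; exact: sqr_ge0.
rewrite (big_cat_nat (n := N))//= ?leq_addr//.
have head : \sum_(0 <= n < N) rnorm (hardy_coef (f - g) n) ^+ 2 <= e ^+ 2 / 4.
  apply: (@le_trans _ _ (\sum_(0 <= n < N) d ^+ 2)).
    rewrite !big_nat; apply: ler_sum => i /andP[_ iN].
    rewrite Defs.coefB gs nth_mkseq// ler_pXn2r ?nnegrE ?rnorm_ge0 ?(ltW d0)//.
    exact: ltW (aP i).2.
  rewrite sumr_const_nat subn0 -[_ *+ N]mulr_natr /d expr_div_n [leLHS]mulrAC.
  rewrite ler_pdivrMr; last by rewrite exprn_gt0// mulr_gt0 ?ltr0n.
  have -> : e ^+ 2 / 4 * (2 * N.+1%:R) ^+ 2 = e ^+ 2 * N.+1%:R ^+ 2 by field.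
  rewrite ler_wpM2l ?sqr_ge0// -natrX ler_nat.
  by rewrite (leq_trans (leqnSn N))// leq_pmulr.
have := sum_coef_le f (N + K); rewrite (big_cat_nat (n := N))//= ?leq_addr//.
have -> : \sum_(N <= n < N + K) rnorm (hardy_coef (f - g) n) ^+ 2 =
    \sum_(N <= n < N + K) rnorm (hardy_coef f n) ^+ 2.
  rewrite !big_nat; apply: eq_bigr => i /andP[Ni _].
  by rewrite Defs.coefB gs nth_default ?size_mkseq// subr0.
move: head tail; lra.
Qed.

(** Polynomials with coefficients in a countable dense set are dense, and finite sequences of
    naturals enumerate them. *)
Lemma separable_hardy (D : hilbertType R) :
  separable_space D -> separable_space (hardy D).
Proof.
move=> [S cS dS].
have [num num_inj] := countable_injP _ cS.
pose dec n := xget 0 [set x | S x /\ num x = n].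
have numK x : S x -> dec (num x) = x.
  move=> Sx; rewrite /dec; case: xgetP => [y _ [Sy xy]|/(_ x)/(_ (conj Sx erefl))//].
  by apply: num_inj; rewrite ?in_setE.
have sq (s : seq D) : square_summable (nth 0 s).
  apply/square_summableP; exists (\sum_(0 <= k < size s) rnorm s`_k ^+ 2) => N.
  apply: (@le_trans _ _ (\sum_(0 <= k < size s + N) rnorm s`_k ^+ 2)).
    rewrite addnC [leRHS](big_cat_nat (n := N))//= ?leq_addr// lerDl.
    by rewrite sumr_ge0// => i _; exact: sqr_ge0.
  rewrite (big_cat_nat (n := size s))//= ?leq_addr// gerDl.
  rewrite big_nat big1// => i /andP[Ni _].
  by rewrite nth_default// rnorm0 expr0n.
exists (range (fun s : seq nat => hardy_of (sq (map dec s)))).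
  exact: (card_le_trans (card_image_le _ _) (countableP _)).
move=> O [f Of] oO.
have [e /= e0 feO] : nbhs_ball f O by rewrite nbhs_ballE; exact: open_nbhs_nbhs.
have eE : e = (complex.Re e)%:C by rewrite RRe_real// gtr0_real.
have [|s [sS sP]] := hardy_polynomial_approx f dS (e := complex.Re e).
  by rewrite -ltcR -eE.
have sE : map dec (map num s) = s.
  by rewrite -map_comp map_id_in// => x /sS /numK.
exists (hardy_of (sq (map dec (map num s)))); split; last by exists (map num s).
apply: feO; rewrite -ball_normE/= eE rnormE ltcR; apply: sP => n.
by rewrite coef_hardy_of sE.
Qed.

End HardySpace.

Section Defect.
Context {R : realType} {H : hilbertType R}.

Section Alternating.
Context (Q Q' : {linear H -> H}) (cQ : contractive Q) (cQ' : contractive Q')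
  (QQ' : forall x y, '[Q x, y] = '[x, Q' y]).

Fixpoint alternate n (x : H) : H :=
  if n is m.+1 then (if odd m then Q' else Q) (alternate m x) else x.

Lemma alternate_linear n : linear (alternate n).
Proof.
elim: n => [|n IHn] a u v //=.
by rewrite IHn; case: odd; rewrite linearP.
Qed.

Lemma dot_alternate n x :
  '[alternate n x, alternate n.+2 x] = '[alternate n.+1 x, alternate n.+1 x].
Proof.
by rewrite /=; case: odd => /=; rewrite ?QQ'// [LHS]dotC QQ' -dotC.
Qed.

Lemma rnorm_alternate_diff n x :
  rnorm (alternate n x - alternate n.+2 x) ^+ 2 =
  (rnorm (alternate n x) ^+ 2 - rnorm (alternate n.+1 x) ^+ 2) -
  (rnorm (alternate n.+1 x) ^+ 2 - rnorm (alternate n.+2 x) ^+ 2).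
Proof.
rewrite rnorm_sqrD rnormN linearNr raddfN/= dot_alternate -rnorm_sqr; ring.
Qed.

Lemma rnorm_alternateS n x : rnorm (alternate n.+1 x) <= rnorm (alternate n x).
Proof.
have /contractiveP hQ := cQ; have /contractiveP hQ' := cQ'.
by rewrite /=; case: odd.
Qed.

Lemma sum_alternate_diff x :
  \sum_(0 <= n < N) rnorm (alternate n x - alternate n.+2 x) ^+ 2 @[N --> \oo] -->
  rnorm x ^+ 2 - rnorm (Q x) ^+ 2.
Proof.
pose a n := rnorm (alternate n x) ^+ 2.
have a0 n : 0 <= a n by exact: sqr_ge0.
have aS n : a n.+1 <= a n.
  by rewrite /a ler_pXn2r ?nnegrE ?rnorm_ge0// rnorm_alternateS.
have ca : cvgn a.
  apply: nonincreasing_is_cvgn; first by apply/nonincreasing_seqP.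
  by exists 0 => _ [n _ <-].
have sumE N : \sum_(0 <= n < N) rnorm (alternate n x - alternate n.+2 x) ^+ 2 =
    (a 0%N - a 1%N) - (a N - a N.+1).
  elim: N => [|N IHN]; first by rewrite big_geq// subrr.
  by rewrite big_nat_recr//= IHN rnorm_alternate_diff -!/(a _); ring.
rewrite (_ : (fun N => _) = fun N => (a 0%N - a 1%N) - (a N - a N.+1));
  last exact/funext.
rewrite -[X in _ --> X]subr0.
apply: cvgB; first exact: cvg_cst.
rewrite -[X in _ --> X](subrr (limn a)); apply: cvgB => //.
by rewrite (cvg_shiftS a).
Qed.

End Alternating.

Lemma ex_defect (Q Q' : {linear H -> H}) : contractive Q -> contractive Q' ->
  (forall x y, '[Q x, y] = '[x, Q' y]) ->
  exists A : {linear H -> hardy H},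
    forall x, rnorm (A x) ^+ 2 = rnorm x ^+ 2 - rnorm (Q x) ^+ 2.
Proof.
move=> cQ cQ' QQ'.
have dL n : linear (fun x => alternate Q Q' n x - alternate Q Q' n.+2 x).
  by move=> a u v; rewrite !alternate_linear scalerBr opprD addrACA.
have [A [_ AE]] := ex_hardy_map dL (sum_alternate_diff cQ cQ' QQ').
by exists A.
Qed.

End Defect.

Section Model.
Context {R : realType} {H : hilbertType R}.

Lemma ex_model (Q Q' : {linear H -> H}) : contractive Q -> contractive Q' ->
  (forall x y, '[Q x, y] = '[x, Q' y]) ->
  (forall x, iter m Q x @[m --> \oo] --> (0 : H)) ->
  exists L : {linear H -> hardy (hardy H)},
    (forall x, rnorm (L x) = rnorm x) /\
    forall x n, hardy_coef (L (Q x)) n = hardy_coef (L x) n.+1.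
Proof.
move=> cQ cQ' QQ' Q0; have [A AE] := ex_defect cQ cQ' QQ'.
have iterL n : linear (fun x => A (iter n Q x)).
  move=> a u v; rewrite -linearP; congr (A _).
  by elim: n => //= n ->; rewrite linearP.
have sumA x : \sum_(0 <= n < N) rnorm (A (iter n Q x)) ^+ 2 @[N --> \oo] -->
    rnorm x ^+ 2.
  have sumE N : \sum_(0 <= n < N) rnorm (A (iter n Q x)) ^+ 2 =
      rnorm x ^+ 2 - rnorm (iter N Q x) ^+ 2.
    elim: N => [|N IHN]; first by rewrite big_geq// subrr.
    by rewrite big_nat_recr//= IHN AE; ring.
  rewrite (_ : (fun N => _) = fun N => rnorm x ^+ 2 - rnorm (iter N Q x) ^+ 2);
    last exact/funext.
  rewrite -[X in _ --> X]subr0.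
  apply: cvgB; first exact: cvg_cst.
  under eq_fun do rewrite expr2.
  by rewrite -[0](mul0r 0) -(@rnorm0 _ H); apply: cvgM; exact: cvg_rnorm.
have [L [LC LE]] := ex_hardy_map iterL sumA.
exists L; split=> [x|x n]; last by rewrite !LC -iterSr.
by apply/eqP; rewrite -(@eqrXn2 _ 2) ?rnorm_ge0// LE.
Qed.

End Model.

Theorem theorem2p2 (R : realType) (H : hilbertType R)
    (sepH : separable_space H)
    (T : {linear H -> H}) (bddT : bounded_operator T) (T_Cdot0 : C_dot0 T)
    (S : set H) (S_subspace : closed_subspace S) (S_nontrivial : S <> [set 0]) :
  T @` S `<=` S <->
  exists (D : hilbertType R) (Pi : {linear hardy D -> H}),
    [/\ separable_space D,
        partial_isometry Pi,
        Pi \o hardy_shift = T \o Pi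
      & S = range Pi].
Proof.
split=> [TS|[D [Pi [_ _ PiT ->]]]]; last first.
  move=> _ [_ [f _ <-] <-]; exists (hardy_shift f) => //.
  exact: (congr1 (@^~ f) PiT).
have [cT T0] := T_Cdot0.
have [T' TT'] := ex_adjoint bddT.
have T'E : adjoint T = T'.
  by apply/funext => y; apply: hdot_inj => x; rewrite -adjointP// TT'.
rewrite T'E in T0.
have cT' := adjoint_contractive cT TT'.
have [P [SP PS PP]] := ex_projection S_subspace.
have cP : contractive P.
  apply/contractiveP => x; rewrite -(@ler_pXn2r _ 2) ?nnegrE ?rnorm_ge0//.
  have : rnorm (P x) ^+ 2 <= rnorm x * rnorm (P x).
    rewrite rnorm_sqr PP PS// (le_trans (ler_norm _))//.
    exact: Re_dot_le.
  by have := sqr_ge0 (rnorm (P x) - rnorm x); lra.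
pose Q : {linear H -> H} := P \o T'; pose Q' : {linear H -> H} := T \o P.
have cQ : contractive Q by move=> x; exact: le_trans (cP _) (cT' _).
have cQ' : contractive Q' by move=> x; exact: le_trans (cT _) (cP _).
have QQ' x y : '[Q x, y] = '[x, Q' y].
  by rewrite /= PP dotC -TT' -dotC.
have QP x : Q (P x) = Q x.
  apply: hdot_injl => w; rewrite !QQ'/= PP PS//.
  by apply: TS; exists (P w).
have iterQ m x : iter m.+1 Q x = P (iter m.+1 T' x).
  by elim: m => // m IHm; rewrite iterS IHm QP.
have Q0 x : iter m Q x @[m --> \oo] --> (0 : H).
  apply/cvg_rnormP => e e0; have /cvg_rnormP/(_ _ e0) := T0 x.
  case=> N _ NT; exists N.+1 => // -[//|m] Nm; rewrite iterQ.
  rewrite rnormB subr0; have /contractiveP h := cP.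
  rewrite (le_lt_trans (h _))//.
  have := NT m.+1; rewrite /= rnormB subr0; apply; exact: ltnW.
have [L [LE LQ]] := ex_model cQ cQ' QQ' Q0.
pose V : {linear H -> hardy (hardy H)} := L \o P.
have VE x : rnorm (V x) = rnorm (P x) by rewrite LE.
have cV : contractive V.
  by move: cP => /contractiveP cP; apply/contractiveP => x; rewrite VE.
have [Pi VPi] := ex_adjoint (contractive_bounded cV).
have PiV x : Pi (V x) = P x.
  by apply: hdot_inj => w; rewrite -VPi (polarization VE) PP PS.
have PPi f : P (Pi f) = Pi f.
  by apply: hdot_inj => w; rewrite -PP -(VPi (P w) f) -(VPi w f)/= (PS _ (SP w)).
exists (hardy H), Pi; split; first exact: separable_hardy.
- split=> [|f fker].
    exact: contractive_bounded (adjoint_contractive cV VPi).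
  have fE : '[f, f] = '[f, V (Pi f)].
    apply/eqP; rewrite -subr_eq0 -linearBr/=; apply/eqP; apply: fker.
    by rewrite linearB/= PiV PPi subrr.
  have fPi : rnorm (Pi f) ^+ 2 = rnorm f ^+ 2.
    by rewrite !rnorm_sqr [in RHS]fE Re_dotC VPi.
  rewrite 2!rnormE; suff -> : rnorm (Pi f) = rnorm f by [].
  by apply: pexpIrn fPi; rewrite ?nnegrE ?rnorm_ge0.
- apply/funext => f; apply: hdot_injl => w /=.
  rewrite [LHS]dotC -VPi -dotC (@hardy_dot_shift _ _ _ _ (V (T' w))); last first.
    by move=> n; rewrite /= -[P (T' w)]/(Q w) -QP LQ.
  by rewrite dotC VPi -dotC TT'.
- apply/seteqP; split=> [x Sx|_ [f _ <-]]; last by rewrite -PPi.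
  by exists (V x) => //; rewrite PiV PS.
Qed.
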